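(* Let $\Pi$ be an orientable no-fold product structure, even or odd, with $|A|,|B|\ge 2$. Then $\operatorname{girth}(L_1)\in\{4,6\}$ (with the convention that forests have girth $\infty$). Moreover, if $\operatorname{girth}(L_1)=6$ then $\operatorname{girth}(L_{AB})\le 5$; equivalently, $\operatorname{girth}(L_{AB})\ge 6$ forces $\operatorname{girth}(L_1)=4$.
   Context: A product structure of type $(m,n)$ is a triple $\Pi=(A,B,P)$ with $A,B$ finite (disjoint) sets, $|A|=m$, $|B|=n$, and $P$ a partition of $A\times B$ into cells such that if two distinct positions $(a,b),(a',b')$ lie in the same cell then $a\ne a'$ and $b\ne b'$. It is even if every cell has size $2$, and odd if exactly one cell has size $1$ and all others have size $2$. Horizontal graphs: $L_A$ is the simple graph on $A$ in which $\{a,a'\}$ is an edge iff there are $b,b'\in B$ with $\{(a,b),(a',b')\}\in P$; $L_B$ is the simple graph on $B$ in which $\{b,b'\}$ is an edge iff there are $a,a'\in A$ with $\{(a,b),(a',b')\}\in P$. $L_{AB}=L_A\sqcup L_B$. Colors are the classes of the equivalence relation on $E(L_A)\sqcup E(L_B)$ generated by declaring, for each 2-cell $\{(a,b),(a',b')\}$, the edge $\{a,a'\}$ equivalent to the edge $\{b,b'\}$. A coherent orientation $O$ is a choice of one direction for each edge of $L_A$ and $L_B$ such that for every 2-cell $\{(a,b),(a',b')\}$ either $a\to a'$ and $b\to b'$, or $a'\to a$ and $b'\to b$. $(\Pi,O)$ is no-fold if no vertex has two distinct outgoing edges of the same color or two distinct incoming edges of the same color. An orientable no-fold product structure is one admitting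 a coherent orientation $O$ with $(\Pi,O)$ no-fold, considered together with any one such fixed $O$. Each color $c$ has two signed colors $(c,\mathrm{out}),(c,\mathrm{in})$. The middle link $L_1$ is the simple bipartite graph with parts $A\sqcup B$ and the set of signed colors, where $v$ is adjacent to $(c,\mathrm{out})$ iff $v$ is the tail of some edge of color $c$, and to $(c,\mathrm{in})$ iff $v$ is the head of some edge of color $c$. Girth is the length of a shortest cycle, $\infty$ for acyclic graphs; the girth of a disconnected graph is the minimum over its components. *)

(* Defs.v *)
From mathcomp Require Import all_boot.

Set Implicit Arguments.
Unset Strict Implicit.
Unset Printing Implicit Defensive.

(** A finite simple graph is a (symmetric, irreflexive) [e : rel T] on a
    [finType]. Extended natural numbers are [option nat], [None] being the
    infinite value (the girth of a forest). *)

Definition ext_le (g h : option nat) : bool :=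
  match g, h with
  | _, None => true
  | None, Some _ => false
  | Some k, Some l => k <= l
  end.

Section Girth.
Variables (T : finType) (e : rel T).

(* The bound 2 < k excludes the closed walk u - v - u, which [ucycleb] accepts. *)
Definition has_cycle (k : nat) : bool :=
  (2 < k) && [exists s : k.-tuple T, ucycleb e s].

(* A cycle has at most #|T| vertices, so the search can be bounded;
   [girth_SomeP] and [girth_NoneP] show that this loses nothing. *)
Definition girth : option nat :=
  ohead [seq k <- iota 0 #|T|.+1 | has_cycle k].

Lemma has_cycleP k :
  reflect (exists s : seq T, [/\ size s = k, 2 < k & ucycle e s])
          (has_cycle k).
Proof.
apply: (iffP andP) => [[k2 /existsP[s sc]]|[s [sk k2 sc]]].
  by exists s; rewrite size_tuple.
split=> //; apply/existsP.
by move/eqP: sk => sk; exists (Tuple sk).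
Qed.

Lemma has_cycle_bound k : has_cycle k -> k < #|T|.+1.
Proof.
by case/has_cycleP=> s [<- _ /andP[_ us]]; rewrite ltnS -(card_uniqP us) max_card.
Qed.

Lemma girth_NoneP : girth = None <-> forall k, ~~ has_cycle k.
Proof.
rewrite /girth; split=> [h k|h].
  apply/negP => hk; have: k \in [seq k <- iota 0 #|T|.+1 | has_cycle k].
    by rewrite mem_filter hk mem_iota add0n has_cycle_bound.
  by case: [seq k <- _ | _] h.
by rewrite (@eq_filter _ _ pred0) ?filter_pred0 // => k; apply/negbTE.
Qed.

Lemma girth_SomeP g :
  girth = Some g <-> has_cycle g /\ forall k, has_cycle k -> g <= k.
Proof.
rewrite /girth; set r := filter _ _.
have rP k : (k \in r) = has_cycle k.
  rewrite mem_filter mem_iota add0n leq0n /=.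
  by case hk: (has_cycle k) => //=; rewrite has_cycle_bound.
have: sorted leq r by apply/sorted_filter/iota_sorted; exact: leq_trans.
case: r rP => [|x r] rP /= sr.
  by split=> // -[]; rewrite -rP.
have xmin k : has_cycle k -> x <= k.
  rewrite -rP inE => /orP[/eqP->//|kr].
  by have /allP/(_ k kr) := order_path_min leq_trans sr.
have hx : has_cycle x by rewrite -rP mem_head.
split=> [[<-]//|[hg gmin]]; congr Some.
by apply/eqP; rewrite eqn_leq xmin ?gmin.
Qed.

End Girth.

(** Taking [A] and [B] to be types makes them disjoint in [A + B]; the type
    (m, n) of the structure is (#|A|, #|B|). *)
Record product_structure (A B : finType) := ProductStructure {
  cells : {set {set A * B}};
  cells_partition : partition cells [set: A * B];
  cells_generic : forall C p q, C \in cells -> p \in C -> q \in C ->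
    p != q -> (p.1 != q.1) && (p.2 != q.2)
}.

Section ProductStructure.
Variables (A B : finType) (Pi : product_structure A B).

Definition even_structure : Prop :=
  forall C, C \in cells Pi -> #|C| = 2.

Definition odd_structure : Prop :=
  exists C0, [/\ C0 \in cells Pi, #|C0| = 1 &
    forall C, C \in cells Pi -> C != C0 -> #|C| = 2].

(* For p = q the pair [set p; q] is a 1-cell, hence the disequality. *)
Definition two_cell (p q : A * B) : bool :=
  (p != q) && ([set p; q] \in cells Pi).

Definition LA : rel A := fun a a' =>
  [exists b, exists b', two_cell (a, b) (a', b')].

Definition LB : rel B := fun b b' =>
  [exists a, exists a', two_cell (a, b) (a', b')].

Definition LAB : rel (A + B) := fun u v =>
  match u, v with
  | inl a, inl a' => LA a a'
  | inr b, inr b' => LB b b'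
  | _, _ => false
  end.

Lemma LAB_sym : symmetric LAB.
Proof.
have tC p q : two_cell p q = two_cell q p.
  by rewrite /two_cell eq_sym setUC.
case=> [a|b] [a'|b'] //=; apply/existsP/existsP => -[x /existsP[y h]];
  by exists y; apply/existsP; exists x; rewrite tC.
Qed.

Lemma LAB_irr : irreflexive LAB.
Proof.
case=> x /=; apply/negbTE/existsP => -[y /existsP[z /andP[ne xP]]];
  have := cells_generic xP (set21 _ _) (set22 _ _) ne;
  by rewrite /= eqxx ?andbF.
Qed.

(* E(LA) and E(LB), disjoint as sets of unordered pairs in A + B. *)
Definition edges : {set {set A + B}} :=
  [set [set uv.1; uv.2] | uv : (A + B) * (A + B) & LAB uv.1 uv.2].

Definition cell_link (e f : {set A + B}) : bool :=
  [exists p, exists q, two_cell p q &&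
    ((e == [set inl p.1; inl q.1]) && (f == [set inr p.2; inr q.2]))].

Definition color_rel : rel {set A + B} :=
  connect (fun e f => cell_link e f || cell_link f e).

Definition colors : {set {set {set A + B}}} :=
  equivalence_partition color_rel edges.

(* A color is a set of edges: [e \in val c] reads "e has color c". *)
Definition color : finType := {c : {set {set A + B}} | c \in colors}.

Section Orientation.
(* [O u v] reads "the edge {u, v} is directed from u to v". *)
Variable O : rel (A + B).

Record coherent_orientation : Prop := CoherentOrientation {
  orient_edge : forall u v, O u v -> LAB u v;
  orient_choice : forall u v, LAB u v -> O u v (+) O v u;
  orient_coherent : forall p q, two_cell p q ->
    (O (inl p.1) (inl q.1) /\ O (inr p.2) (inr q.2)) \/
    (O (inl q.1) (inl p.1) /\ O (inr q.2) (inr p.2))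
}.

Definition no_fold : Prop :=
  forall (c : color) (u v w : A + B),
    [set u; v] \in val c -> [set u; w] \in val c ->
    (O u v -> O u w -> v = w) /\ (O v u -> O w u -> v = w).

(* Signed colors: (c, true) is (c, out), (c, false) is (c, in). *)
Definition signed_color : finType := (color * bool)%type.

Definition incident (v : A + B) (s : signed_color) : bool :=
  [exists w, (if s.2 then O v w else O w v) && ([set v; w] \in val s.1)].

Definition L1 : rel ((A + B) + signed_color) := fun x y =>
  match x, y with
  | inl v, inr s | inr s, inl v => incident v s
  | _, _ => false
  end.

End Orientation.
End ProductStructure.

Arguments L1 {A B} Pi O.

(* Main.v *)
Require Import Defs.
From mathcomp Require Import all_boot.

(** View every signed color as a "line" on the points [A + B]. A position
    lying in a 2-cell gives a line through its two coordinates, so all pairs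
    (a, b), with at most one exception (a0, b0), are collinear; if L1 has no
    4-cycle, two points lie on at most one common line. A vertex meets at most
    deg v lines, where deg is its degree in LAB, and a line s and its opposite
    (the other sign of the color) have equally many points in B.

    If no line has two points in B then |B| <= deg a < |A| for a <> a0; by
    symmetry we may assume that some line s has two points in B. If L1 has no
    6-cycle either, every a <> a0 lies on s and on its opposite, or else it
    forms a triangle with two points of s. Hence |A| = 2, but the vertex
    a <> a0 has an incoming and an outgoing edge: contradiction.

    If LAB has girth at least 6, let q be the largest number of points in B of
    a line, attained by s. Covering B by the lines through a gives
    |B| <= q deg a, and joining a to the points of s gives deg a >= q for all a
    but the unique point z of A common to s and its opposite (with a loss of 1
    at a0). Counting the ball of radius 2 around z gives |A| > q deg z >= |B|;
    the loss of 1 at a0 is made up by a vertex at distance 3. Exchanging A and B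
    gives a contradiction. *)

Set Implicit Arguments.
Unset Strict Implicit.
Unset Printing Implicit Defensive.

Lemma card_gt1_neq (T : finType) (P : {set T}) x :
  1 < #|P| -> exists y, y \in P /\ y != x.
Proof.
case/card_gt1P=> [y [z [yP zP yz]]]; case: (eqVneq y x) => [E|]; last by exists y.
by exists z; rewrite -E eq_sym.
Qed.

(** * Short cycles and balls of radius two in a graph *)

Section GirthBounds.
Variables (V : finType) (e : rel V).

Lemma girth_ge_has_cycle g k :
  ext_le (Some g) (girth e) -> k < g -> ~~ has_cycle e k.
Proof.
case eg: (girth e) => [h|] /=; last by move=> _ _; apply: (girth_NoneP _).1.
move=> gh kg; apply/negP=> ck.
have [_ hmin] := (girth_SomeP e h).1 eg.
by have := leq_trans kg (leq_trans gh (hmin k ck)); rewrite ltnn.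
Qed.

Hypotheses (e_sym : symmetric e) (e_irr : irreflexive e).

Lemma adj_neq u v : e u v -> u != v.
Proof. by apply: contraTneq => ->; rewrite e_irr. Qed.

Lemma no_cycle3 : ~~ has_cycle e 3 ->
  forall a b c, e a b -> e b c -> ~~ e c a.
Proof.
move=> no3 a b c ab bc; apply: contra no3 => ca.
apply/has_cycleP; exists [:: a; b; c]; split=> //.
by rewrite /ucycle /= ab bc ca !inE /= (eq_sym a c) !negb_or !adj_neq.
Qed.

Lemma no_cycle4 : ~~ has_cycle e 4 ->
  forall a b c d, e a b -> e b c -> e c d -> e d a -> a != c -> b = d.
Proof.
move=> no4 a b c d ab bc cd da ac; apply/eqP/negPn; apply: contra no4 => bd.
apply/has_cycleP; exists [:: a; b; c; d]; split=> //.
by rewrite /ucycle /= ab bc cd da !inE /= (eq_sym a d) !negb_or ac bd !adj_neq.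
Qed.

Lemma no_cycle5 : ~~ has_cycle e 3 -> ~~ has_cycle e 5 ->
  forall a b c d f, e a b -> e b c -> e c d -> e d f -> ~~ e f a.
Proof.
move=> no3 no5 a b c d f ab bc cd df; apply: contra no5 => fa.
(* If two vertices at distance two on the pentagon coincided, the other three edges would form a
   triangle. *)
have neq2 u v w x y : e u v -> e w x -> e x y -> e y u -> u != w.
  by move=> _ wx xy yu; apply: contraTneq yu => ->; apply: no_cycle3 xy.
apply/has_cycleP; exists [:: a; b; c; d; f]; split=> //.
rewrite /ucycle /= ab bc cd df fa !inE /= !negb_or.
rewrite (eq_sym a d) (eq_sym a f) (eq_sym b f).
rewrite (neq2 _ _ _ _ _ ab cd df fa) (neq2 _ _ _ _ _ bc df fa ab).
by rewrite (neq2 _ _ _ _ _ cd fa ab bc) (neq2 _ _ _ _ _ df ab bc cd)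
  (neq2 _ _ _ _ _ fa bc cd df) !adj_neq.
Qed.

Definition nbhd v := [set w | e v w].

(** Counts walks of length two from [a]. [W] is left free so that [a], or [a] and a vertex at
    distance three, can be removed from [X]. *)
Lemma sum_nbhd_le a (W : {set V}) :
    ~~ has_cycle e 3 -> ~~ has_cycle e 4 ->
    (forall x, e a x -> x \in W) ->
    (forall x y, e a x -> e x y -> y != a -> y \in W) ->
  \sum_(x in nbhd a) #|nbhd x| <= #|W|.
Proof.
move=> no3 no4 W1 W2.
pose P := [set p | e a p.1 && e p.1 p.2].
pose g (p : V * V) := if p.2 == a then p.1 else p.2.
have -> : \sum_(x in nbhd a) #|nbhd x| = #|P|.
  transitivity (\sum_(x in nbhd a) \sum_(y in nbhd x) 1).
    by apply: eq_bigr => x _; rewrite sum1_card.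
  by rewrite pair_big_dep -sum1_card; apply: eq_bigl => p; rewrite !inE.
(* A walk [a x a] is sent to [x], a walk [a x y] with [y != a] to [y]. *)
have gI : {in P &, injective g}.
  move=> [x y] [x' y']; rewrite !inE /g /= => /andP[ax xy] /andP[ax' xy'].
  case: eqVneq xy => [->|ya] xy; case: eqVneq xy' => [->|ya'] xy' E.
  - by rewrite E.
  - by have := no_cycle3 no3 ax' xy'; rewrite -E e_sym ax.
  - by have := no_cycle3 no3 ax xy; rewrite E e_sym ax'.
  - move: xy'; rewrite -E => yx'; congr pair.
    by apply: (no_cycle4 no4 ax xy); rewrite 1?e_sym // eq_sym.
rewrite -(card_in_imset gI); apply/subset_leq_card/subsetP => w.
case/imsetP=> -[x y]; rewrite !inE /g /= => /andP[ax xy] ->.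
by case: eqVneq => ya; [apply: W1 | apply: W2 xy ya].
Qed.

Variable X : {set V}.
Hypothesis e_X : forall x y, x \in X -> e x y -> y \in X.
Hypotheses (no3 : ~~ has_cycle e 3) (no4 : ~~ has_cycle e 4).

Lemma card_ball2 a : a \in X -> \sum_(x in nbhd a) #|nbhd x| < #|X|.
Proof.
move=> aX; rewrite (cardsD1 a X) aX ltnS; apply: sum_nbhd_le => // [x ax|x y ax xy].
  by rewrite !inE eq_sym adj_neq //= (e_X aX).
by rewrite !inE => -> /=; apply: e_X xy; apply: e_X ax.
Qed.

(** A neighbour [w != x] of [y] is one more vertex of [X], at distance three from [a]: any shorter
    way back would close a cycle of length 3, 4 or 5. *)
Lemma card_ball2_lt a x y : ~~ has_cycle e 5 -> a \in X ->
    e a x -> e x y -> y != a -> 1 < #|nbhd y| ->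
  (\sum_(x in nbhd a) #|nbhd x|).+1 < #|X|.
Proof.
move=> no5 aX ax xy ya /(card_gt1_neq x)[w []]; rewrite inE => yw wx.
have xX := e_X aX ax; have yX := e_X xX xy; have wX := e_X yX yw.
have wa : w != a.
  by apply: contraTneq yw => ->; apply: no_cycle3 ax xy.
rewrite (cardsD1 a X) aX (cardsD1 w) !inE wa wX !add1n !ltnS.
apply: sum_nbhd_le => // [u au|u v au uv va].
  rewrite !inE (eq_sym u a) (adj_neq au) (e_X aX au) !andbT.
  apply: contraTneq au => E; apply/negP=> aw; rewrite E in aw.
  by move: wx; rewrite -(@no_cycle4 no4 a x y w) ?eqxx // 1?e_sym // eq_sym.
rewrite !inE va (e_X (e_X aX au) uv) !andbT; apply: contraTneq uv => ->.
apply/negP=> uw; have := no_cycle5 no3 no5 ax xy yw; rewrite e_sym in uw.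
by move/(_ _ uw); rewrite e_sym au.
Qed.

End GirthBounds.

(** * Counting in a partial linear space with opposite lines *)

Section LineSystem.
Variables (V S : finType) (e : rel V) (inc : V -> S -> bool) (bar : S -> S).
Variables (X Y : {set V}) (x0 y0 : V).

Definition lines v := [set s | inc v s].
(** Only the side [Y] counts: [X] and [Y] stand for [A] and [B] in either order. *)
Definition points s := [set y in Y | inc y s].

Hypotheses (e_sym : symmetric e) (e_irr : irreflexive e).
Hypothesis e_X : forall x y, x \in X -> e x y -> y \in X.
Hypothesis lines_le : forall v, #|lines v| <= #|nbhd e v|.
Hypothesis bar_neq : forall s, bar s != s.
Hypothesis points_bar : forall s, #|points s| <= #|points (bar s)|.
Hypothesis linear :
  forall u v s t, u != v -> inc u s -> inc v s -> inc u t -> inc v t -> s = t.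
Hypothesis XY : forall x y, x \in X -> y \in Y -> x != y.
(* [(x0, y0)] is the 1-cell of an odd structure. *)
Hypothesis cover : forall x y, x \in X -> y \in Y -> (x, y) != (x0, y0) ->
  exists s, inc x s && inc y s.
Hypotheses (x0X : x0 \in X) (X1 : 1 < #|X|) (Y1 : 1 < #|Y|).

Lemma card_nbhd_lt x : x \in X -> #|nbhd e x| < #|X|.
Proof.
move=> xX; rewrite (cardsD1 x X) xX ltnS; apply/subset_leq_card/subsetP => y.
by rewrite !inE => xy; rewrite eq_sym (adj_neq e_irr xy) (e_X xX).
Qed.

(** Only [x0] can fail to be joined to some point of [Y], namely [y0]; hence the correction
    [(x == x0)] in the later bounds. *)
Lemma card_remove_exception x (P : {set V}) :
  #|P| <= #|[set y in P | (x, y) != (x0, y0)]| + (x == x0).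
Proof.
rewrite -(cardsID [set y | (x, y) != (x0, y0)] P); apply: leq_add.
  by apply/subset_leq_card/subsetP => y; rewrite !inE.
apply: (@leq_trans #|if x == x0 then [set y0] else set0|).
  apply/subset_leq_card/subsetP => y; rewrite !inE negbK xpair_eqE.
  by case: eqP => //= _ /andP[]; rewrite inE.
by case: eqP; rewrite ?cards1 ?cards0.
Qed.

Lemma card_le_lines_mul x q : x \in X -> (forall s, #|points s| <= q) ->
  #|Y| <= #|lines x| * q + (x == x0).
Proof.
move=> xX maxq; apply: leq_trans (card_remove_exception x Y) _.
rewrite leq_add2r -sum_nat_const.
apply: (@leq_trans (\sum_(s in lines x) #|points s|)); last exact: leq_sum.
apply: (@leq_trans #|\bigcup_(s in lines x) points s|); last first.
  elim/big_rec2: _ => [|s n U _ nU]; first by rewrite cards0.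
  by apply: leq_trans (leq_card_setU _ _).1 _; rewrite leq_add2l.
apply/subset_leq_card/subsetP => y; rewrite inE => /andP[yY xy].
have [s /andP[xs ys]] := cover xX yY xy.
by apply/bigcupP; exists s; rewrite !inE ?yY.
Qed.

(** Distinct points of [s] are joined to [x] by distinct lines: a line through two of them is [s],
    which misses [x]. *)
Lemma card_points_le x s : x \in X -> ~~ inc x s ->
  #|points s| <= #|lines x| + (x == x0).
Proof.
move=> xX xs; apply: leq_trans (card_remove_exception x (points s)) _.
rewrite leq_add2r; set P := [set y in _ | _].
pose f y := odflt s [pick t | inc x t && inc y t].
have fP y : y \in P -> inc x (f y) && inc y (f y).
  rewrite !inE => /andP[/andP[yY _] xy]; rewrite /f; case: pickP => //= no.
  by have [t] := cover xX yY xy; rewrite no.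
have fI : {in P &, injective f}.
  move=> y y' yP y'P E; apply/eqP/negPn/negP => yy'.
  have /andP[xt yt] := fP y yP; have /andP[_ y't] := fP y' y'P.
  rewrite -E in y't; move: yP y'P; rewrite !inE.
  move=> /andP[/andP[_ ys] _] /andP[/andP[_ y's] _].
  by move: xs; rewrite (linear yy' ys y's yt y't) xt.
rewrite -(card_in_imset fI); apply/subset_leq_card/subsetP => t.
by case/imsetP=> y /fP/andP[xt _] ->; rewrite inE.
Qed.

Lemma card_lt_of_points_le1 : (forall s, #|points s| <= 1) -> #|Y| < #|X|.
Proof.
move=> q1; have [x [xX /negbTE xx0]] := card_gt1_neq x0 X1.
have := card_le_lines_mul xX q1; rewrite xx0 muln1 addn0 => le.
by apply: leq_ltn_trans le _; apply: leq_ltn_trans (lines_le x) (card_nbhd_lt xX).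
Qed.

Lemma inc_bar_inj u v s :
  inc u s -> inc u (bar s) -> inc v s -> inc v (bar s) -> u = v.
Proof.
move=> us ubs vs vbs; apply/eqP/negPn/negP => uv.
by have := bar_neq s; rewrite -(linear uv us vs ubs vbs) eqxx.
Qed.

Lemma card_nbhd_gt1 u s : inc u s -> inc u (bar s) -> 1 < #|nbhd e u|.
Proof.
move=> us ubs; apply: leq_trans (lines_le u); apply/card_gt1P.
by exists (bar s), s; rewrite !inE.
Qed.

(** [x] misses [s] or [bar s], and [bar s] has at least as many points as [s]. *)
Lemma card_points_le_nbhd x s :
    x \in X -> ~~ (inc x s && inc x (bar s)) ->
  #|points s| <= #|nbhd e x| + (x == x0).
Proof.
move=> xX; have le n : n <= #|lines x| + (x == x0) -> n <= #|nbhd e x| + (x == x0).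
  by move/leq_trans; apply; rewrite leq_add2r.
rewrite negb_and => /orP[] xs; apply: le; first exact: card_points_le.
by apply: leq_trans (points_bar s) _; apply: card_points_le.
Qed.

Lemma points_le1_of_no_triangle s :
  (forall u v w r s t, u != v -> v != w -> u != w -> inc u r -> inc v r ->
     inc v s -> inc w s -> inc w t -> inc u t -> r = s) ->
  #|points s| <= 1.
Proof.
move=> no_tri; rewrite leqNgt; apply/negP=> s1.
(* A line with two points in [Y] contains every [x != x0] of [X], or [x] and these points would form
   a triangle. *)
have inc_s t x : 1 < #|points t| -> x \in X -> x != x0 -> inc x t.
  case/card_gt1P=> y1 [y2 []]; rewrite !inE => /andP[yY1 yt1] /andP[yY2 yt2].
  move=> y12 xX /negbTE xx0.
  have ne y : (x, y) != (x0, y0) by rewrite xpair_eqE xx0.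
  have [t1 /andP[xt1 y1t1]] := cover xX yY1 (ne y1).
  have [t2 /andP[xt2 y2t2]] := cover xX yY2 (ne y2).
  by rewrite -(no_tri x y1 y2 t1 t t2) // XY.
have [x [xX xx0]] := card_gt1_neq x0 X1.
have s1' := leq_trans s1 (points_bar s).
have xs := inc_s _ _ s1 xX xx0; have xs' := inc_s _ _ s1' xX xx0.
(* Two neighbours of [x] give [#|X| >= 3], hence some [x'] other than [x] and [x0]; it lies on [s]
   and [bar s] too. *)
have := leq_ltn_trans (card_nbhd_gt1 xs xs') (card_nbhd_lt xX).
rewrite (cardsD1 x0) x0X ltnS => /(card_gt1_neq x)[x' []].
rewrite !inE => /andP[x'x0 x'X]; rewrite (@inc_bar_inj x' x s) ?eqxx //;
  exact: inc_s.
Qed.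

Lemma card_lt_of_no_triangle :
  (forall u v w r s t, u != v -> v != w -> u != w -> inc u r -> inc v r ->
     inc v s -> inc w s -> inc w t -> inc u t -> r = s) ->
  #|Y| < #|X|.
Proof.
by move=> no_tri; apply: card_lt_of_points_le1 => s; apply: points_le1_of_no_triangle.
Qed.

Lemma card_lt_of_no_short_cycle :
  ~~ has_cycle e 3 -> ~~ has_cycle e 4 -> ~~ has_cycle e 5 -> #|Y| < #|X|.
Proof.
move=> no3 no4 no5.
(* A pair other than [(x0, y0)] provides a first line, so the maximum is taken over a nonempty
   set. *)
have [s maxs] : exists s, forall t, #|points t| <= #|points s|.
  have [x [xX /negbTE xx0]] := card_gt1_neq x0 X1.
  have [y [_ [yY _ _]]] := card_gt1P Y1.
  have [|s0 _] := cover xX yY; first by rewrite xpair_eqE xx0.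
  case: (@arg_maxnP _ s0 xpredT (fun t => #|points t|)) => // s _ maxs.
  by exists s => t; apply: maxs.
have [q1|q2] := leqP #|points s| 1.
  by apply: card_lt_of_points_le1 => t; apply: leq_trans (maxs t) q1.
set q := #|points s| in maxs q2.
have card_Y a : a \in X -> #|Y| <= #|nbhd e a| * q + (a == x0).
  move=> aX; apply: leq_trans (card_le_lines_mul aX maxs) _.
  by rewrite leq_add2r leq_mul2r lines_le orbT.
(* Over the neighbours of [a], the corrections [(x == x0)] add up to [e a x0]. *)
have sum_ge a : (forall x, e a x -> q <= #|nbhd e x| + (x == x0)) ->
    #|nbhd e a| * q <= \sum_(x in nbhd e a) #|nbhd e x| + e a x0.
  move=> ge; have -> : nat_of_bool (e a x0) = \sum_(x in nbhd e a) (x == x0).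
    case: (boolP (e a x0)) => ax0.
      rewrite (bigD1 x0) ?inE //= eqxx big1 // => x /andP[_ /negbTE ->] //.
    by rewrite big1 // => x; rewrite inE; apply: contraTeq => /eqP;
      case: eqP => // -> _.
  by rewrite -big_split -sum_nat_const /=; apply: leq_sum => x; rewrite inE => /ge.
(* Center the ball at [z] if it exists and is not [x0], and at [x0] otherwise. *)
have [z /and4P[zX zs zbs zx0]|noz] :=
  pickP [pred z | [&& z \in X, inc z s, inc z (bar s) & z != x0]].
  have ge x : x \in X -> x != z -> q <= #|nbhd e x| + (x == x0).
    move=> xX xz; apply: card_points_le_nbhd => //.
    apply: contra xz => /andP[xs xbs]; apply/eqP.
    exact: inc_bar_inj xs xbs zs zbs.
  have le : #|Y| <= \sum_(x in nbhd e z) #|nbhd e x| + e z x0.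
    apply: leq_trans (card_Y z zX) _; rewrite (negbTE zx0) addn0.
    apply: sum_ge => x zx; apply: ge; first exact: e_X zx.
    by rewrite eq_sym; apply: adj_neq zx.
  apply: leq_ltn_trans le _; case zx0': (e z x0); last first.
    by rewrite addn0; apply: card_ball2.
  have ge' x : x \in X -> x != z -> x != x0 -> 1 < #|nbhd e x|.
    move=> xX xz /negbTE xx0; apply: leq_trans q2 _.
    by have := ge x xX xz; rewrite xx0 addn0.
  (* Here [x0] is a neighbour of [z] and costs 1. The path to a vertex at distance three starts with
     [x != x0]; then [y != x0], for lack of triangles, so [y] has a second neighbour. *)
  have [x []] := card_gt1_neq x0 (card_nbhd_gt1 zs zbs); rewrite inE => zx xx0.
  have xX := e_X zX zx; have xz : x != z by rewrite eq_sym (adj_neq e_irr zx).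
  have [y []] := card_gt1_neq z (ge' x xX xz xx0); rewrite inE => xy yz.
  rewrite addn1; apply: (@card_ball2_lt _ _ _ _ _ _ _ _ z x y) => //.
  apply: ge' => //; first exact: e_X xy.
  apply: contraTneq zx0' => E; rewrite e_sym -E.
  exact: no_cycle3 zx xy.
have ge x : x \in X -> x != x0 -> q <= #|nbhd e x|.
  move=> xX xx0; have := @card_points_le_nbhd x s xX; rewrite (negbTE xx0) addn0.
  by apply; have := noz x; rewrite /= xX xx0 /= andbT => /negbT.
(* With center [x0] the loss of 1 comes from [y0], perhaps not joined to [x0], and not from the
   degrees of the neighbours. *)
have Yle := card_Y x0 x0X; rewrite eqxx addn1 in Yle.
have /card_gt0P[x] : 0 < #|nbhd e x0|.
  by case: #|nbhd e x0| Yle => [|//]; rewrite mul0n leqNgt Y1.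
rewrite inE => x0x; have xX := e_X x0X x0x.
have xx0 : x != x0 by rewrite eq_sym (adj_neq e_irr x0x).
have [y []] := card_gt1_neq x0 (leq_trans q2 (ge x xX xx0)); rewrite inE => xy yx0.
apply: leq_ltn_trans Yle _.
apply: leq_ltn_trans (@card_ball2_lt _ e _ _ X _ _ _ x0 x y _ _ _ _ _ _) => //.
  have := sum_ge x0; rewrite e_irr addn0 ltnS; apply=> u x0u.
  apply: leq_trans (leq_addr _ _); apply: ge; first exact: e_X x0u.
  by rewrite eq_sym (adj_neq e_irr x0u).
by apply: leq_trans q2 (ge y _ yx0); apply: e_X xy.
Qed.

End LineSystem.

(** * Signed colors as lines, and the cycles of [L1] *)

Lemma bipartite_even_cycle (T : Type) (e : rel T) (h : T -> bool) (s : seq T) :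
  (forall x y, e x y -> h y = ~~ h x) -> cycle e s -> ~~ odd (size s).
Proof.
move=> he; have last_h p : forall x, path e x p -> h (last x p) = h x (+) odd (size p).
  elim: p => [|y p IH] x /=; first by rewrite addbF.
  by case/andP=> /he hy /IH ->; rewrite hy addNb addbN.
case: s => //= x p /last_h; rewrite last_rcons size_rcons /=.
by case: (h x); case: odd.
Qed.

Section Colors.
Variables (A B : finType) (Pi : product_structure A B) (O : rel (A + B)).

Lemma color_inj f (c c' : color Pi) : f \in val c -> f \in val c' -> c = c'.
Proof.
set R := fun e f => cell_link Pi e f || cell_link Pi f e.
have symR : symmetric R by move=> x y; rewrite /R orbC.
have eqR : {in edges Pi & &, equivalence_rel (color_rel Pi)}.
  move=> x y z _ _ _; split; first exact: connect0.
  by move=> xy; apply: (same_connect (sym_connect_sym symR) xy).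
have /and3P[_ triv _] := equivalence_partitionP eqR.
move=> fc fc'; apply: val_inj.
by rewrite -(def_pblock triv (valP c) fc) -(def_pblock triv (valP c') fc').
Qed.

Lemma two_cell_color p q : two_cell Pi p q ->
  exists c : color Pi, [set inl p.1; inl q.1] \in val c /\
                       [set inr p.2; inr q.2] \in val c.
Proof.
move=> pq; set f := [set inl p.1; inl q.1]; set g := [set _; _].
have fE : f \in edges Pi.
  apply/imsetP; exists (inl p.1, inl q.1) => //; rewrite inE /=.
  by apply/existsP; exists p.2; apply/existsP; exists q.2; rewrite -!surjective_pairing.
have gE : g \in edges Pi.
  apply/imsetP; exists (inr p.2, inr q.2) => //; rewrite inE /=.
  by apply/existsP; exists p.1; apply/existsP; exists q.1; rewrite -!surjective_pairing.
have fg : color_rel Pi f g.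
  apply: connect1; apply/orP; left.
  by apply/existsP; exists p; apply/existsP; exists q; rewrite pq !eqxx.
have cC : [set h in edges Pi | color_rel Pi f h] \in colors Pi by exact: imset_f.
by exists (exist (fun c => c \in colors Pi) _ cC); rewrite !inE fE gE fg /color_rel connect0.
Qed.

Lemma two_cell_cover :
    even_structure Pi \/ odd_structure Pi -> 0 < #|A| -> 0 < #|B| ->
  exists p0, forall p, p != p0 -> exists q, two_cell Pi p q.
Proof.
move=> parity /card_gt0P[a _] /card_gt0P[b _].
have /and3P[/eqP covP triv _] := cells_partition Pi.
have pbP p : pblock (cells Pi) p \in cells Pi by rewrite pblock_mem // covP.
have card2 p : #|pblock (cells Pi) p| = 2 -> exists q, two_cell Pi p q.
  move/eqP/cards2P=> [x [y [xy E]]].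
  have: p \in [set x; y] by rewrite -E mem_pblock covP.
  move: (pbP p); rewrite E /two_cell !inE => xyP /orP[] /eqP ->.
    by exists y; rewrite xy xyP.
  by exists x; rewrite eq_sym xy setUC xyP.
case: parity => [even|[C0 [C0P /eqP/cards1P[p0 C0E] odd]]].
  (* In the even case [p0] is an arbitrary position. *)
  by exists (a, b) => p _; apply: card2; apply: even.
exists p0 => p pp0; apply: card2; apply: odd => //.
apply: contraNneq pp0 => E; rewrite -in_set1 -C0E -E mem_pblock covP inE //.
Qed.

Hypotheses (coh : coherent_orientation Pi O) (nf : no_fold Pi O).

(** [incident] with its witness exposed: [w] is the other end of the edge that puts [v] on [s]. *)
Definition along (v : A + B) (s : signed_color Pi) (w : A + B) : bool :=
  (if s.2 then O v w else O w v) && ([set v; w] \in val s.1).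

Definition bar (s : signed_color Pi) : signed_color Pi := (s.1, ~~ s.2).

Lemma bar_neq s : bar s != s.
Proof. by case: s => c []; rewrite xpair_eqE negb_and orbT. Qed.

Lemma along_bar u s v : along u s v -> along v (bar s) u.
Proof. by rewrite /along setUC /=; case: s.2. Qed.

Lemma along_LAB u s v : along u s v -> LAB Pi u v.
Proof.
by rewrite /along; case: s.2 => /andP[/(orient_edge coh)]; rewrite // LAB_sym.
Qed.

Lemma along_inj u v s w : along u s w -> along v s w -> u = v.
Proof.
case: s => c [] /andP[/= uw uc] /andP[/= vw vc];
  rewrite setUC in uc; rewrite setUC in vc; have [out_inj in_inj] := nf uc vc.
  exact: in_inj.
exact: out_inj.
Qed.

Lemma along_signed_color_inj v s t w : along v s w -> along v t w -> s = t.
Proof.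
move=> vs vt; have := orient_choice coh (along_LAB vs).
case: s t vs vt => c b [c' b'] /andP[/= sw sc] /andP[/= tw tc].
rewrite (color_inj sc tc); case: b sw; case: b' tw => // -> ->//.
Qed.

Definition along_end v s := odflt v [pick w | along v s w].

Lemma along_endP v s : incident O v s -> along v s (along_end v s).
Proof.
by rewrite /along_end; case: pickP => //= no /existsP[w]; rewrite -[_ && _]/(along v s w) no.
Qed.

(** A line through [v] yields an edge at [v], whose color and direction determine the line. *)
Lemma card_lines_le v : #|lines (@incident A B Pi O) v| <= #|nbhd (LAB Pi) v|.
Proof.
have nI : {in lines (@incident A B Pi O) v &, injective (along_end v)}.
  move=> s t; rewrite !inE => /along_endP vs /along_endP vt E.
  by rewrite -E in vt; apply: along_signed_color_inj vs vt.
rewrite -(card_in_imset nI); apply/subset_leq_card/subsetP => w.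
by case/imsetP=> s; rewrite !inE => /along_endP vs ->; apply: along_LAB vs.
Qed.

(** Moving along [s] sends its points to points of [bar s], injectively by no-fold. *)
Lemma card_points_bar (Y : {set A + B}) s :
    (forall u v, u \in Y -> LAB Pi u v -> v \in Y) ->
  #|points (@incident A B Pi O) Y s| <= #|points (@incident A B Pi O) Y (bar s)|.
Proof.
move=> LY.
have nI : {in points (@incident A B Pi O) Y s &, injective (along_end^~ s)}.
  move=> u v; rewrite !inE => /andP[_ /along_endP us] /andP[_ /along_endP vs] E.
  by rewrite -E in vs; apply: along_inj us vs.
rewrite -(card_in_imset nI); apply/subset_leq_card/subsetP => w.
case/imsetP=> v; rewrite !inE => /andP[vY /along_endP vs] ->.
rewrite (LY _ _ vY (along_LAB vs)); apply/existsP; exists v.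
exact: along_bar vs.
Qed.

(** The two edges of a 2-cell share a color, and coherence gives them the same sign at [p]. *)
Lemma two_cell_incident p q : two_cell Pi p q ->
  exists s : signed_color Pi, incident O (inl p.1) s && incident O (inr p.2) s.
Proof.
move=> pq; have [c [pc qc]] := two_cell_color pq.
case: (orient_coherent coh pq) => [] [o1 o2].
  exists (c, true); apply/andP; split; apply/existsP.
    by exists (inl q.1); rewrite /= o1.
  by exists (inr q.2); rewrite /= o2.
exists (c, false); apply/andP; split; apply/existsP.
  by exists (inl q.1); rewrite /= o1.
by exists (inr q.2); rewrite /= o2.
Qed.

Lemma L1_even_cycle k : has_cycle (L1 Pi O) k -> ~~ odd k.
Proof.
case/has_cycleP=> s [<- _ /andP[+ _]].
apply: (@bipartite_even_cycle _ _ (fun x => if x is inl _ then true else false)).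
by case=> x [] y.
Qed.

Lemma girth_L1_4 : has_cycle (L1 Pi O) 4 -> girth (L1 Pi O) = Some 4.
Proof.
move=> c4; apply/girth_SomeP; split=> // k ck; have /andP[k3 _] := ck.
rewrite ltn_neqAle k3 andbT; apply: contraNneq (L1_even_cycle ck) => <- //.
Qed.

Lemma girth_L1_6 : ~~ has_cycle (L1 Pi O) 4 -> has_cycle (L1 Pi O) 6 ->
  girth (L1 Pi O) = Some 6.
Proof.
move=> no4 c6; apply/girth_SomeP; split=> // k ck; have /andP[k3 _] := ck.
rewrite leqNgt; apply: contra (L1_even_cycle ck) => k6.
have k4 : k != 4 by apply: contraNneq no4 => <-.
by case: k k3 k6 k4 {ck} => [|[|[|[|[|[|]]]]]].
Qed.

Lemma incident_linear : ~~ has_cycle (L1 Pi O) 4 ->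
  forall u v (s t : signed_color Pi), u != v -> incident O u s -> incident O v s ->
    incident O u t -> incident O v t -> s = t.
Proof.
move=> no4 u v s t uv us vs ut vt; apply/eqP/negPn; apply: contra no4 => st.
apply/has_cycleP; exists [:: inl u; inr s; inl v; inr t]; split=> //.
rewrite /ucycle /= us vs ut vt !inE /= !(inj_eq inl_inj) !(inj_eq inr_inj).
by rewrite negb_or uv st.
Qed.

(** By linearity any two equal sides force [r = s]; so [r != s] makes the triangle a 6-cycle. *)
Lemma incident_no_triangle :
    ~~ has_cycle (L1 Pi O) 4 -> ~~ has_cycle (L1 Pi O) 6 ->
  forall u v w (r s t : signed_color Pi), u != v -> v != w -> u != w ->
    incident O u r -> incident O v r -> incident O v s -> incident O w s ->
    incident O w t -> incident O u t -> r = s.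
Proof.
move=> no4 no6 u v w r s t uv vw uw ur vr vs ws wt ut.
have lin := incident_linear no4.
apply/eqP/negPn; apply: contra (no6) => rs.
have st : s != t.
  by apply: contraNneq rs => E; rewrite -E in ut; apply/eqP/(lin u v).
have rt : r != t.
  by apply: contraNneq rs => E; rewrite -E in wt; apply/eqP/(lin v w).
apply/has_cycleP; exists [:: inl u; inr r; inl v; inr s; inl w; inr t]; split=> //.
rewrite /ucycle /= ur vr vs ws wt ut !inE /= !(inj_eq inl_inj) !(inj_eq inr_inj).
by rewrite !negb_or uv uw rs vw rt st.
Qed.

End Colors.

Theorem corollary1p3 (A B : finType) (Pi : product_structure A B)
    (O : rel (A + B)) :
  2 <= #|A| -> 2 <= #|B| ->
  even_structure Pi \/ odd_structure Pi ->
  coherent_orientation Pi O -> no_fold Pi O ->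
  [/\ girth (L1 Pi O) = Some 4 \/ girth (L1 Pi O) = Some 6,
      girth (L1 Pi O) = Some 6 -> ext_le (girth (LAB Pi)) (Some 5) &
      ext_le (Some 6) (girth (LAB Pi)) -> girth (L1 Pi O) = Some 4].
Proof.
move=> A2 B2 parity coh nf.
have [p0 cov] := two_cell_cover parity (ltnW A2) (ltnW B2).
pose X := [set inl a | a : A] : {set A + B}.
pose Y := [set inr b | b : B] : {set A + B}.
have LX u v : u \in X -> LAB Pi u v -> v \in X.
  by case/imsetP=> a _ ->; case: v => // a' _; apply: imset_f.
have LY u v : u \in Y -> LAB Pi u v -> v \in Y.
  by case/imsetP=> b _ ->; case: v => // b' _; apply: imset_f.
have X2 : 1 < #|X| by rewrite card_imset //; apply: inl_inj.
have Y2 : 1 < #|Y| by rewrite card_imset //; apply: inr_inj.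
have XY x y : x \in X -> y \in Y -> x != y.
  by case/imsetP=> a _ -> /imsetP[b _ ->].
have YX x y : x \in Y -> y \in X -> x != y.
  by move=> xY yX; rewrite eq_sym XY.
have covXY x y : x \in X -> y \in Y -> (x, y) != (inl p0.1, inr p0.2) ->
    exists s : signed_color Pi, incident O x s && incident O y s.
  case/imsetP=> a _ -> /imsetP[b _ ->] ne.
  by have [|q /(two_cell_incident coh)] := cov (a, b).
have covYX x y : x \in Y -> y \in X -> (x, y) != (inr p0.2, inl p0.1) ->
    exists s : signed_color Pi, incident O x s && incident O y s.
  move=> xY yX ne; have [|s /andP[sy sx]] := covXY y x yX xY.
    by move: ne; rewrite !xpair_eqE andbC.
  by exists s; rewrite sx sy.
have x0X : inl p0.1 \in X by apply: imset_f.
have y0Y : inr p0.2 \in Y by apply: imset_f.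
have irr := @LAB_irr A B Pi; have sym := @LAB_sym A B Pi.
have lines_le := card_lines_le coh; have bar_ne := @bar_neq A B Pi.
have barX s := card_points_bar coh nf s LX.
have barY s := card_points_bar coh nf s LY.
have cycle46 : ~~ has_cycle (L1 Pi O) 4 -> has_cycle (L1 Pi O) 6.
  move=> no4; apply: contraT => no6.
  have lin := incident_linear no4; have no_tri := incident_no_triangle no4 no6.
  (* The two applications give [#|Y| < #|X|] and [#|X| < #|Y|]. *)
  have := ltn_trans
    (card_lt_of_no_triangle irr LX lines_le bar_ne barY lin XY covXY x0X X2 no_tri)
    (card_lt_of_no_triangle irr LY lines_le bar_ne barX lin YX covYX y0Y Y2 no_tri).
  by rewrite ltnn.
have girth6 : ext_le (Some 6) (girth (LAB Pi)) -> has_cycle (L1 Pi O) 4.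
  move=> g6; apply: contraT => no4; have lin := incident_linear no4.
  have no k : k < 6 -> ~~ has_cycle (LAB Pi) k by exact: girth_ge_has_cycle.
  have := ltn_trans
    (card_lt_of_no_short_cycle sym irr LX lines_le bar_ne barY lin covXY x0X
       X2 Y2 (no 3 isT) (no 4 isT) (no 5 isT))
    (card_lt_of_no_short_cycle sym irr LY lines_le bar_ne barX lin covYX y0Y
       Y2 X2 (no 3 isT) (no 4 isT) (no 5 isT)).
  by rewrite ltnn.
split.
- case: (boolP (has_cycle (L1 Pi O) 4)) => [/girth_L1_4|no4]; first by left.
  by right; apply: girth_L1_6 (cycle46 no4).
- move=> L6; case: (boolP (ext_le _ _)) => // h.
  have /girth6/girth_L1_4 : ext_le (Some 6) (girth (LAB Pi)).
    by case: (girth _) h => //= g; rewrite -ltnNge.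
  by rewrite L6.
- by move=> /girth6/girth_L1_4.
Qed.
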